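(* Let $\ell$ be a commutative ring with unit. Let $G$ be a finite group acting freely on a finite simplicial set $X$. Suppose moreover that $\mathrm{St}(v)\cap \mathrm{St}\big(\overline{\mathrm{St}(g\cdot v)}\big)=\emptyset$ for every $v\in X_0$ and every $g\in G$, $g\neq e$. Then the unital algebras $\ell^{X/G}$ and $\ell^{X}\rtimes G$ are Morita equivalent.
   Context: Stars: for a simplicial set $X$ and a vertex $v\in X_0$, $\mathrm{St}(v)=\mathrm{St}_X(v)$ is the set of all simplices of $X$ having $v$ as one of their vertices; $\overline{\mathrm{St}(v)}$ is the simplicial subset of $X$ generated by $\mathrm{St}(v)$; for a simplicial subset $K\subseteq X$, $\mathrm{St}(K)=\bigcup_{v\in K_0}\mathrm{St}(v)$. A simplicial set is finite if it has finitely many non-degenerate simplices. $G$ acts on $X$ by simplicial automorphisms, and freely means that $g\cdot\sigma\neq\sigma$ for every simplex $\sigma$ and every $g\ne e$. $X/G$ is the quotient simplicial set. Piecewise polynomial functions: $\ell^{\Delta}$ is the simplicial ring $[n]\mapsto \ell^{\Delta^n}=\ell[t_0,\dots,t_n]/\langle t_0+\cdots+t_n-1\rangle$, where $\alpha:[m]\to[n]$ acts by $t_i\mapsto\sum_{\alpha(j)=i}t_j$, and $\ell^X=\hom_{\mathbf{sSet}}(X,\ell^{\Delta})$, an $\ell$-algebra with pointwise operations. $G$ acts on $\ell^X$ by $(g\cdot\phi)(\sigma)=\phi(g^{-1}\cdot\sigma)$. Crossed product: for a $G$-algebra $A$ (an $\ell$-algebra with an action of $G$ by automorphisms), $A\rtimes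 G=A\otimes_\ell\ell[G]$ as a module, with product $(a\rtimes g)(b\rtimes h)=a(g\cdot b)\rtimes gh$. Unital $\ell$-algebras $R,S$ are Morita equivalent if there are an $S$-$R$-bimodule $P$, an $R$-$S$-bimodule $Q$, an $S$-bimodule isomorphism $\alpha:P\otimes_RQ\to S$ and an $R$-bimodule isomorphism $\beta:Q\otimes_SP\to R$ such that $\alpha(p\otimes q)\cdot p'=p\cdot\beta(q\otimes p')$ and $\beta(q\otimes p)\cdot q'=q\cdot\alpha(p\otimes q')$ for all $p,p'\in P$, $q,q'\in Q$. *)

(* Defs.v *)
From HB Require Import structures.
From mathcomp Require Import all_boot all_algebra all_fingroup.
From mathcomp Require Import generic_quotient ring_quotient.
From mathcomp Require Import boolp classical_sets cardinality.
From mathcomp Require Import finmap.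
From mathcomp.multinomials Require Import xfinmap monalg.

Set Implicit Arguments.
Unset Strict Implicit.
Unset Printing Implicit Defensive.

Import GRing.Theory.
Local Open Scope quotient_scope.
Local Open Scope classical_set_scope.
Local Open Scope ring_scope.

(* Unital algebras over [l]. MathComp's [algType] excludes the zero ring, which
   does occur here ([l = 0], or functions on the empty simplicial set). *)
HB.mixin Record PzRing_isPzAlgebra (l : comPzRingType) A of GRing.PzRing A := {
  pzscale : l -> A -> A;
  pzscaleA : forall a b (x : A), pzscale a (pzscale b x) = pzscale (a * b) x;
  pzscale1 : left_id 1 pzscale;
  pzscaleDr : right_distributive pzscale +%R;
  pzscaleDl : forall x, {morph pzscale^~ x : a b / a + b};
  pzscaleAl : forall a (x y : A), pzscale a (x * y) = pzscale a x * y;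
  pzscaleAr : forall a (x y : A), pzscale a (x * y) = x * pzscale a y
}.

#[short(type="pzAlgType")]
HB.structure Definition PzAlgebra (l : comPzRingType) :=
  {A of GRing.PzRing A & PzRing_isPzAlgebra l A}.

(* Polynomials in [n] variables. The carrier is that of monalg, but its
   product is only defined there over non-zero coefficient rings. *)
Section Polynomials.
Variables (l : comPzRingType) (n : nat).

Definition mpol : Type := {mpoly l[n]}.
HB.instance Definition _ := GRing.Zmodule.on mpol.

(* Locked against unwanted unfolding during unification. *)
Fact mpol_key : unit. Proof. exact: tt. Qed.

Definition mpolU : l -> 'X_{1..n} -> mpol :=
  locked_with mpol_key (fun c m => << c *g m >>).

Definition mpol_mul : mpol -> mpol -> mpol := locked_with mpol_key
  (fun p q => \sum_(m1 <- msupp p) \sum_(m2 <- msupp q)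
     mpolU (mcoeff m1 p * mcoeff m2 q) (mmul m1 m2)).

Lemma mpolUE c m : mpolU c m = << c *g m >>.
Proof. by rewrite /mpolU locked_withE. Qed.

Lemma mpol_mulE p q : mpol_mul p q =
  \sum_(m1 <- msupp p) \sum_(m2 <- msupp q)
    mpolU (mcoeff m1 p * mcoeff m2 q) (mmul m1 m2).
Proof. by rewrite /mpol_mul locked_withE. Qed.

Lemma mpolU0 m : mpolU 0 m = 0.
Proof. by rewrite mpolUE monalgU0. Qed.

Lemma mpolUD m c c' : mpolU (c + c') m = mpolU c m + mpolU c' m.
Proof. by rewrite !mpolUE monalgUD. Qed.

Lemma mpol_sumU (p : mpol) : p = \sum_(m <- msupp p) mpolU (mcoeff m p) m.
Proof.
by rewrite {1}(monalgE p); apply: eq_bigr => m _; rewrite mpolUE.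
Qed.

Lemma mpol_mulw (d1 d2 : {fset 'X_{1..n}}) (p q : mpol) :
  (msupp p `<=` d1)%fset -> (msupp q `<=` d2)%fset ->
  mpol_mul p q = \sum_(m1 <- d1) \sum_(m2 <- d2)
    mpolU (mcoeff m1 p * mcoeff m2 q) (mmul m1 m2).
Proof.
move=> le1 le2; rewrite mpol_mulE (big_fset_incl _ le1) /=.
  apply: eq_bigr => m1 _; apply/big_fset_incl => // m _ /mcoeff_outdom ->.
  by rewrite mulr0 mpolU0.
move=> m _ /mcoeff_outdom p0; rewrite big1 // => m' _.
by rewrite p0 mul0r mpolU0.
Qed.

Lemma mpol_mulC : commutative mpol_mul.
Proof.
move=> p q; rewrite !mpol_mulE exchange_big; apply: eq_bigr => m1 _.
by apply: eq_bigr => m2 _; rewrite mulrC mulmC.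
Qed.

Lemma mpol_mulUU c1 c2 m1 m2 :
  mpol_mul (mpolU c1 m1) (mpolU c2 m2) = mpolU (c1 * c2) (mmul m1 m2).
Proof.
rewrite (mpolUE c1) (mpolUE c2) (mpol_mulw msuppU_le msuppU_le).
by rewrite !big_seq_fset1 !mcoeffUU.
Qed.

Lemma mpol_mulDl : left_distributive mpol_mul +%R.
Proof.
move=> p1 p2 q; have leq := fsubset_refl (msupp q).
rewrite (mpol_mulw (msuppD_le p1 p2) leq).
rewrite (mpol_mulw (fsubsetUl (msupp p1) (msupp p2)) leq).
rewrite (mpol_mulw (fsubsetUr (msupp p1) (msupp p2)) leq).
rewrite -big_split; apply: eq_bigr => m1 _ /=.
rewrite -big_split; apply: eq_bigr => m2 _ /=.
by rewrite mcoeffD mulrDl mpolUD.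
Qed.

Lemma mpol_mulDr : right_distributive mpol_mul +%R.
Proof. by move=> p q r; rewrite !(mpol_mulC p) mpol_mulDl. Qed.

Lemma mpol_ext (f g : mpol -> mpol) :
  {morph f : x y / x + y} -> {morph g : x y / x + y} ->
  (forall c m, f (mpolU c m) = g (mpolU c m)) -> f =1 g.
Proof.
have sumP (h : mpol -> mpol) : {morph h : x y / x + y} -> forall p,
    h p = \sum_(m <- msupp p) h (mpolU (mcoeff m p) m).
  move=> hD p; rewrite {1}(mpol_sumU p); apply: (big_morph h hD).
  by apply: (addIr (h 0)); rewrite -hD !add0r.
move=> fD gD fg p; rewrite (sumP f fD) (sumP g gD).
by apply: eq_bigr => m _; apply: fg.
Qed.

Lemma mpol_mulA : associative mpol_mul.
Proof.
move=> p q r; move: p; apply: mpol_ext => [x y|x y|c1 m1].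
- exact: mpol_mulDl.
- by rewrite (mpol_mulDl x y q) mpol_mulDl.
move: q; apply: mpol_ext => [x y|x y|c2 m2].
- by rewrite (mpol_mulDl x y r) mpol_mulDr.
- by rewrite (mpol_mulDr (mpolU c1 m1) x y) mpol_mulDl.
move: r; apply: mpol_ext => [x y|x y|c3 m3].
- by rewrite (mpol_mulDr (mpolU c2 m2) x y) mpol_mulDr.
- exact: mpol_mulDr.
by rewrite !mpol_mulUU mulrA mulmA.
Qed.

Lemma mpol_mul1 : left_id (mpolU 1 mone) mpol_mul.
Proof.
apply: mpol_ext => // [x y|c m]; first exact: mpol_mulDr.
by rewrite mpol_mulUU mul1r mul1m.
Qed.

HB.instance Definition _ := GRing.Zmodule_isComPzRing.Build mpol
  mpol_mulA mpol_mulC mpol_mul1 mpol_mulDl.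

Lemma mpolUM c1 c2 m1 m2 :
  mpolU c1 m1 * mpolU c2 m2 = mpolU (c1 * c2) (mmul m1 m2).
Proof. exact: mpol_mulUU. Qed.

Definition mpolC (c : l) : mpol := mpolU c mone.
Definition mpolX (i : 'I_n) : mpol := mpolU 1 (ucm i).

Lemma mpolC_is_zmod_morphism : zmod_morphism mpolC.
Proof.
move=> x y; apply: (addIr (mpolC y)).
by rewrite -[LHS]mpolUD [RHS]addrNK addrNK.
Qed.

Lemma mpolC_is_monoid_morphism : monoid_morphism mpolC.
Proof. by split=> // x y; rewrite [RHS]mpolUM mul1m. Qed.

HB.instance Definition _ := GRing.isZmodMorphism.Build l mpol mpolC
  mpolC_is_zmod_morphism.
HB.instance Definition _ := GRing.isMonoidMorphism.Build l mpol mpolC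
  mpolC_is_monoid_morphism.

Lemma mpolX_prod (m : 'X_{1..n}) : \prod_(i < n) mpolX i ^+ m i = mpolU 1 m.
Proof.
pose cmX i k : 'X_{1..n} := iter k (mmul (ucm i)) mone.
have XE i k : mpolX i ^+ k = mpolU 1 (cmX i k).
  elim: k => [|k IHk]; first by rewrite expr0.
  by rewrite exprS IHk mpolUM mulr1.
have cmXE i k j : cmX i k j = ((i == j) * k)%N.
  elim: k => [|k IHk]; first by rewrite muln0 cm1.
  by rewrite [cmX i k.+1]/(mmul (ucm i) (cmX i k)) cmM cmU IHk mulnS.
pose M := \big[@mmul _/mone]_(i < n) cmX i (m i).
have -> : \prod_(i < n) mpolX i ^+ m i = mpolU 1 M.
  rewrite /M; elim/big_rec2: _ => // i x y _ ->.
  by rewrite XE mpolUM mulr1.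
congr mpolU; apply/eqP/cmP => j.
have -> : M j = (\sum_(i < n) (i == j) * m i)%N.
  rewrite /M; elim/big_rec2: _ => [|i x y _ <-]; first by rewrite cm1.
  by rewrite cmM cmXE.
rewrite (bigD1 j) //= eqxx mul1n big1 ?addn0 // => i /negPf ->.
by rewrite mul0n.
Qed.

Lemma mpolE (p : mpol) : p = \sum_(m <- msupp p)
  mpolC (mcoeff m p) * \prod_(i < n) mpolX i ^+ m i.
Proof.
rewrite {1}(mpol_sumU p); apply: eq_bigr => m _.
by rewrite mpolX_prod mpolUM mulr1 mul1m.
Qed.

Section Eval.
Variables (A : comPzRingType) (f : {rmorphism l -> A}) (h : 'I_n -> A).

Definition mpol_eval (p : mpol) : A :=
  \sum_(m <- msupp p) f (mcoeff m p) * \prod_(i < n) h i ^+ m i.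

Lemma mpol_evalw (d : {fset 'X_{1..n}}) (p : mpol) : (msupp p `<=` d)%fset ->
  mpol_eval p = \sum_(m <- d) f (mcoeff m p) * \prod_(i < n) h i ^+ m i.
Proof.
move=> le; rewrite /mpol_eval (big_fset_incl _ le) //= => m _.
by move=> /mcoeff_outdom ->; rewrite rmorph0 mul0r.
Qed.

Lemma mpol_eval_is_zmod_morphism : zmod_morphism mpol_eval.
Proof.
move=> p q; rewrite (mpol_evalw (msuppB_le p q)).
rewrite (mpol_evalw (fsubsetUl (msupp p) (msupp q))).
rewrite (mpol_evalw (fsubsetUr (msupp p) (msupp q))).
rewrite -sumrB; apply: eq_bigr => m _.
by rewrite mcoeffB rmorphB mulrBl.
Qed.

HB.instance Definition _ := GRing.isZmodMorphism.Build mpol A mpol_eval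
  mpol_eval_is_zmod_morphism.

Lemma mpol_evalU c (m : 'X_{1..n}) :
  mpol_eval (mpolU c m) = f c * \prod_(i < n) h i ^+ m i.
Proof. by rewrite mpolUE (mpol_evalw msuppU_le) big_seq_fset1 mcoeffUU. Qed.

Lemma mpol_eval_is_monoid_morphism : monoid_morphism mpol_eval.
Proof.
split=> [|p q].
  by rewrite mpol_evalU rmorph1 mul1r big1 // => i _; rewrite cm1 expr0.
have -> : p * q = mpol_mul p q by [].
rewrite mpol_mulE.
rewrite raddf_sum mulr_suml; apply: eq_bigr => m1 _.
rewrite raddf_sum mulr_sumr; apply: eq_bigr => m2 _.
rewrite [LHS]mpol_evalU rmorphM mulrACA; congr (_ * _).
by rewrite -big_split; apply: eq_bigr => i _; rewrite cmM exprD.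
Qed.

HB.instance Definition _ := GRing.isMonoidMorphism.Build mpol A mpol_eval
  mpol_eval_is_monoid_morphism.

Lemma mpol_evalC c : mpol_eval (mpolC c) = f c.
Proof.
by rewrite mpol_evalU big1 ?mulr1 // => i _; rewrite cm1 expr0.
Qed.

Lemma mpol_evalX i : mpol_eval (mpolX i) = h i.
Proof.
rewrite mpol_evalU rmorph1 mul1r (bigD1 i) //= cmU eqxx expr1 big1 ?mulr1 //.
by move=> j /negPf ji; rewrite cmU eq_sym ji expr0.
Qed.

End Eval.
End Polynomials.

(* The ring l[t_0, ..., t_n] / <t_0 + ... + t_n - 1>. *)
Section SimplexRing.
Variables (l : comPzRingType) (n : nat).

Definition simplex_relation : mpol l n.+1 := \sum_(i < n.+1) mpolX l i - 1.

Definition simplex_ideal : {pred mpol l n.+1} :=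
  fun p => `[< exists q, p = q * simplex_relation >].

Lemma simplex_ideal_zmod_closed : zmod_closed simplex_ideal.
Proof.
split; first by apply/asboolP; exists 0; rewrite mul0r.
move=> p q /asboolP[p' ->] /asboolP[q' ->].
by apply/asboolP; exists (p' - q'); rewrite mulrBl.
Qed.

Lemma simplex_idealM p q : p \in simplex_ideal -> p * q \in simplex_ideal.
Proof.
by move=> /asboolP[p' ->]; apply/asboolP; exists (p' * q); rewrite mulrAC.
Qed.

HB.instance Definition _ := GRing.isZmodClosed.Build (mpol l n.+1)
  simplex_ideal simplex_ideal_zmod_closed.

Definition simplex_ring : Type := {ideal_quot simplex_ideal}.
HB.instance Definition _ := GRing.Zmodule.on simplex_ring.

Definition to_simplex_ring (p : mpol l n.+1) : simplex_ring :=
  \pi_({ideal_quot simplex_ideal}) p.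
Definition of_simplex_ring (x : simplex_ring) : mpol l n.+1 :=
  repr (x : {ideal_quot simplex_ideal}).

Lemma of_simplex_ringK : cancel of_simplex_ring to_simplex_ring.
Proof. exact: reprK. Qed.

Lemma to_simplex_ring_eq p q :
  to_simplex_ring p = to_simplex_ring q <-> p - q \in simplex_ideal.
Proof.
by rewrite /to_simplex_ring Quotient.idealrBE; split => [->|/eqP].
Qed.

Lemma of_to_simplex_ring p :
  of_simplex_ring (to_simplex_ring p) - p \in simplex_ideal.
Proof. by apply/to_simplex_ring_eq; rewrite of_simplex_ringK. Qed.

Lemma to_simplex_ring_is_zmod_morphism : zmod_morphism to_simplex_ring.
Proof. exact: (raddfB \pi_({ideal_quot simplex_ideal})). Qed.

HB.instance Definition _ := GRing.isZmodMorphism.Build (mpol l n.+1)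
  simplex_ring to_simplex_ring to_simplex_ring_is_zmod_morphism.

Definition simplex_ring_mul (x y : simplex_ring) : simplex_ring :=
  to_simplex_ring (of_simplex_ring x * of_simplex_ring y).

Lemma simplex_ring_mulE p q :
  simplex_ring_mul (to_simplex_ring p) (to_simplex_ring q)
  = to_simplex_ring (p * q).
Proof.
apply/to_simplex_ring_eq; set p' := of_simplex_ring _; set q' := of_simplex_ring _.
have -> : p' * q' - p * q = (p' - p) * q' + (q' - q) * p.
  by rewrite !mulrBl (mulrC q' p) (mulrC q p) addrA addrNK.
by rewrite rpredD // simplex_idealM // of_to_simplex_ring.
Qed.

Lemma simplex_ring_mulA : associative simplex_ring_mul.
Proof.
move=> x y z; rewrite -(of_simplex_ringK x) -(of_simplex_ringK y).
by rewrite -(of_simplex_ringK z) !simplex_ring_mulE mulrA.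
Qed.

Lemma simplex_ring_mulC : commutative simplex_ring_mul.
Proof. by move=> x y; rewrite /simplex_ring_mul mulrC. Qed.

Lemma simplex_ring_mul1 : left_id (to_simplex_ring 1) simplex_ring_mul.
Proof.
by move=> x; rewrite -(of_simplex_ringK x) simplex_ring_mulE mul1r.
Qed.

Lemma simplex_ring_mulDl : left_distributive simplex_ring_mul +%R.
Proof.
move=> x y z; rewrite -(of_simplex_ringK x) -(of_simplex_ringK y).
rewrite -(of_simplex_ringK z) -raddfD !simplex_ring_mulE -raddfD.
by rewrite mulrDl.
Qed.

HB.instance Definition _ := GRing.Zmodule_isComPzRing.Build simplex_ring
  simplex_ring_mulA simplex_ring_mulC simplex_ring_mul1 simplex_ring_mulDl.

Lemma to_simplex_ring_is_monoid_morphism : monoid_morphism to_simplex_ring.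
Proof. by split=> // p q; rewrite -simplex_ring_mulE. Qed.

HB.instance Definition _ := GRing.isMonoidMorphism.Build (mpol l n.+1)
  simplex_ring to_simplex_ring to_simplex_ring_is_monoid_morphism.

Definition scst : l -> simplex_ring := to_simplex_ring \o @mpolC l n.+1.
HB.instance Definition _ := GRing.RMorphism.on scst.

Definition svar (i : 'I_n.+1) : simplex_ring := to_simplex_ring (mpolX l i).

Lemma sum_svar : \sum_(i < n.+1) svar i = 1.
Proof.
rewrite -raddf_sum; apply/to_simplex_ring_eq/asboolP.
by exists 1; rewrite mul1r.
Qed.

Definition simplex_ring_scale (a : l) (x : simplex_ring) : simplex_ring :=
  scst a * x.

Lemma simplex_ring_scaleA a b x :
  simplex_ring_scale a (simplex_ring_scale b x) = simplex_ring_scale (a * b) x.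
Proof. by rewrite /simplex_ring_scale rmorphM mulrA. Qed.

Lemma simplex_ring_scale1 : left_id 1 simplex_ring_scale.
Proof. by move=> x; rewrite /simplex_ring_scale rmorph1 mul1r. Qed.

Lemma simplex_ring_scaleDr : right_distributive simplex_ring_scale +%R.
Proof. by move=> a x y; rewrite /simplex_ring_scale mulrDr. Qed.

Lemma simplex_ring_scaleDl x : {morph simplex_ring_scale^~ x : a b / a + b}.
Proof. by move=> a b; rewrite /simplex_ring_scale rmorphD mulrDl. Qed.

Lemma simplex_ring_scaleAl a x y :
  simplex_ring_scale a (x * y) = simplex_ring_scale a x * y.
Proof. exact: mulrA. Qed.

Lemma simplex_ring_scaleAr a x y :
  simplex_ring_scale a (x * y) = x * simplex_ring_scale a y.
Proof. exact: mulrCA. Qed.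

HB.instance Definition _ := PzRing_isPzAlgebra.Build l simplex_ring
  simplex_ring_scaleA simplex_ring_scale1
  simplex_ring_scaleDr simplex_ring_scaleDl
  simplex_ring_scaleAl simplex_ring_scaleAr.

End SimplexRing.

(* [delta m n] is Hom([m], [n]) in the simplex category, [n] = {0, ..., n}. *)
Definition monotone m n (f : {ffun 'I_m.+1 -> 'I_n.+1}) : bool :=
  [forall i : 'I_m.+1, forall j : 'I_m.+1, (i <= j)%N ==> (f i <= f j)%N].

Record delta m n := Delta {
  delta_fun :> {ffun 'I_m.+1 -> 'I_n.+1};
  delta_mono : monotone delta_fun }.

HB.instance Definition _ m n := [isSub for @delta_fun m n].

Lemma deltaP m n (a b : delta m n) : (forall i, a i = b i) -> a = b.
Proof. by move=> eq_ab; apply/val_inj/ffunP. Qed.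

Lemma delta_id_mono n : monotone [ffun i : 'I_n.+1 => i].
Proof.
by apply/forallP => i; apply/forallP => j; apply/implyP; rewrite !ffunE.
Qed.
Definition delta_id n := Delta (delta_id_mono n).

Lemma delta_comp_mono m n p (b : delta n p) (a : delta m n) :
  monotone [ffun i => b (a i)].
Proof.
apply/forallP => i; apply/forallP => j; apply/implyP => le_ij; rewrite !ffunE.
have /forallP/(_ i)/forallP/(_ j)/implyP/(_ le_ij) := delta_mono a.
by have /forallP/(_ (a i))/forallP/(_ (a j))/implyP := delta_mono b.
Qed.
Definition delta_comp m n p (b : delta n p) (a : delta m n) :=
  Delta (delta_comp_mono b a).

Lemma delta_cst_mono n (i : 'I_n.+1) : monotone [ffun _ : 'I_1 => i].
Proof.
by apply/forallP => j; apply/forallP => k; apply/implyP; rewrite !ffunE.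
Qed.
Definition delta_cst n (i : 'I_n.+1) : delta 0 n := Delta (delta_cst_mono i).

Section SimplexRingMap.
Variable l : comPzRingType.

(* t_i |-> \sum_(a j = i) t_j *)
Definition simplex_ring_map m n (a : delta m n)
    (x : simplex_ring l n) : simplex_ring l m :=
  mpol_eval (@scst l m) (fun i => \sum_(j < m.+1 | a j == i) svar l j)
    (of_simplex_ring x).

Lemma simplex_ring_mapE m n (a : delta m n) p :
  simplex_ring_map a (to_simplex_ring p) =
  mpol_eval (@scst l m) (fun i => \sum_(j < m.+1 | a j == i) svar l j) p.
Proof.
rewrite /simplex_ring_map; apply/eqP; rewrite -subr_eq0 -rmorphB.
have /asboolP[q ->] := of_to_simplex_ring p.
rewrite rmorphM rmorphB rmorph1 rmorph_sum /=.
under eq_bigr do rewrite mpol_evalX.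
rewrite -(sum_svar l m) [X in _ * (_ - X)](partition_big a xpredT) //=.
by rewrite subrr mulr0.
Qed.

Section Morphism.
Variables (m n : nat) (a : delta m n).

Lemma simplex_ring_map_is_zmod_morphism : zmod_morphism (simplex_ring_map a).
Proof.
move=> x y; rewrite -(of_simplex_ringK x) -(of_simplex_ringK y) -raddfB.
by rewrite !simplex_ring_mapE raddfB.
Qed.

Lemma simplex_ring_map_is_monoid_morphism :
  monoid_morphism (simplex_ring_map a).
Proof.
split=> [|x y]; first by rewrite simplex_ring_mapE rmorph1.
rewrite -(of_simplex_ringK x) -(of_simplex_ringK y) -rmorphM.
by rewrite !simplex_ring_mapE rmorphM.
Qed.

HB.instance Definition _ := GRing.isZmodMorphism.Build
  (simplex_ring l n) (simplex_ring l m) (simplex_ring_map a)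
  simplex_ring_map_is_zmod_morphism.
HB.instance Definition _ := GRing.isMonoidMorphism.Build
  (simplex_ring l n) (simplex_ring l m) (simplex_ring_map a)
  simplex_ring_map_is_monoid_morphism.

Lemma simplex_ring_map_scst c : simplex_ring_map a (scst n c) = scst m c.
Proof. by rewrite simplex_ring_mapE mpol_evalC. Qed.

Lemma simplex_ring_map_svar i :
  simplex_ring_map a (svar l i) = \sum_(j < m.+1 | a j == i) svar l j.
Proof. by rewrite simplex_ring_mapE mpol_evalX. Qed.

Lemma simplex_ring_map_scale (c : l) x :
  simplex_ring_map a (pzscale c x) = pzscale c (simplex_ring_map a x).
Proof. by rewrite [LHS]rmorphM /= simplex_ring_map_scst. Qed.

End Morphism.

Lemma simplex_ring_rect n (A : comPzRingType)
    (f g : {rmorphism simplex_ring l n -> A}) :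
  (forall c, f (scst n c) = g (scst n c)) ->
  (forall i, f (svar l i) = g (svar l i)) -> f =1 g.
Proof.
move=> fgC fgX x; rewrite -(of_simplex_ringK x) (mpolE (of_simplex_ring x)).
rewrite !rmorph_sum; apply: eq_bigr => m _; rewrite !rmorphM.
congr (_ * _); first exact: fgC.
rewrite !rmorph_prod; apply: eq_bigr => i _; rewrite !rmorphXn.
by congr (_ ^+ _); exact: fgX.
Qed.

Lemma simplex_ring_map_id n (x : simplex_ring l n) :
  simplex_ring_map (delta_id n) x = x.
Proof.
apply: (simplex_ring_rect (f := simplex_ring_map (delta_id n)) (g := idfun)).
  by move=> c; rewrite /= simplex_ring_map_scst.
move=> i; rewrite /= simplex_ring_map_svar.
by under eq_bigl do rewrite ffunE; rewrite big_pred1_eq.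
Qed.

Lemma simplex_ring_map_comp m n p (b : delta n p) (a : delta m n)
    (x : simplex_ring l p) :
  simplex_ring_map (delta_comp b a) x
  = simplex_ring_map a (simplex_ring_map b x).
Proof.
apply: (simplex_ring_rect (f := simplex_ring_map (delta_comp b a))
  (g := simplex_ring_map a \o simplex_ring_map b)) => [c|i] /=.
  by rewrite !simplex_ring_map_scst.
rewrite !simplex_ring_map_svar rmorph_sum /=.
under [RHS]eq_bigr do rewrite simplex_ring_map_svar.
rewrite (partition_big a (fun k => b k == i)) /=.
  apply: eq_bigr => k /eqP bk; apply: eq_bigl => j.
  by rewrite ffunE; case: (a j =P k) => [->|]; rewrite ?bk ?eqxx ?andbF.
by move=> j; rewrite ffunE.
Qed.

End SimplexRingMap.

Record sset := SSet {
  sset_obj :> nat -> choiceType;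
  smap : forall m n, delta m n -> sset_obj n -> sset_obj m;
  smap_id : forall n (x : sset_obj n), smap (delta_id n) x = x;
  smap_comp : forall m n p (b : delta n p) (a : delta m n) (x : sset_obj p),
    smap (delta_comp b a) x = smap a (smap b x) }.

Record shom (X Y : sset) := SHom {
  shom_fun :> forall n, X n -> Y n;
  shom_nat : forall m n (a : delta m n) (x : X n),
    shom_fun (smap a x) = smap a (shom_fun x) }.

Lemma shomP (X Y : sset) (f g : shom X Y) :
  (forall n (x : X n), f n x = g n x) -> f = g.
Proof.
case: f g => [f fN] [g gN] /= eq_fg.
have {eq_fg} eq_fg : f = g by do 2![apply: functional_extensionality_dep => ?].
by case: _ / eq_fg gN => gN; congr SHom; apply: Prop_irrelevance.
Qed.

Definition simplex_ring_sset (l : comPzRingType) : sset :=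
  @SSet (fun n => simplex_ring l n) (@simplex_ring_map l)
    (@simplex_ring_map_id l) (@simplex_ring_map_comp l).

Section PiecewisePolynomial.
Variables (l : comPzRingType) (X : sset).

Definition pwpoly : Type := shom X (simplex_ring_sset l).

HB.instance Definition _ := gen_eqMixin pwpoly.
HB.instance Definition _ := gen_choiceMixin pwpoly.

Implicit Types f g : pwpoly.

Definition pw_ev n (x : X n) f : simplex_ring l n := shom_fun f x.

Lemma pw_evP f g : (forall n (x : X n), pw_ev x f = pw_ev x g) -> f = g.
Proof. exact: (@shomP X (simplex_ring_sset l)). Qed.

Lemma pw_nat m n (a : delta m n) (x : X n) f :
  pw_ev (smap a x) f = simplex_ring_map a (pw_ev x f).
Proof. exact: (@shom_nat X (simplex_ring_sset l)). Qed.

Definition pw_build (F : forall n, X n -> simplex_ring l n)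
    (FN : forall m n (a : delta m n) (x : X n),
       F m (smap a x) = simplex_ring_map a (F n x)) : pwpoly :=
  @SHom X (simplex_ring_sset l) F FN.

Fact pw_zero_nat m n (a : delta m n) (x : X n) :
  0 = simplex_ring_map a (0 : simplex_ring l n).
Proof. by rewrite rmorph0. Qed.
Definition pw_zero : pwpoly := pw_build pw_zero_nat.

Fact pw_one_nat m n (a : delta m n) (x : X n) :
  1 = simplex_ring_map a (1 : simplex_ring l n).
Proof. by rewrite rmorph1. Qed.
Definition pw_one : pwpoly := pw_build pw_one_nat.

Fact pw_opp_nat f m n (a : delta m n) (x : X n) :
  - pw_ev (smap a x) f = simplex_ring_map a (- pw_ev x f).
Proof. by rewrite rmorphN pw_nat. Qed.
Definition pw_opp f : pwpoly := pw_build (pw_opp_nat f).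

Fact pw_add_nat f g m n (a : delta m n) (x : X n) :
  pw_ev (smap a x) f + pw_ev (smap a x) g
  = simplex_ring_map a (pw_ev x f + pw_ev x g).
Proof. by rewrite rmorphD !pw_nat. Qed.
Definition pw_add f g : pwpoly := pw_build (pw_add_nat f g).

Fact pw_mul_nat f g m n (a : delta m n) (x : X n) :
  pw_ev (smap a x) f * pw_ev (smap a x) g
  = simplex_ring_map a (pw_ev x f * pw_ev x g).
Proof. by rewrite rmorphM !pw_nat. Qed.
Definition pw_mul f g : pwpoly := pw_build (pw_mul_nat f g).

Fact pw_scale_nat (c : l) f m n (a : delta m n) (x : X n) :
  pzscale c (pw_ev (smap a x) f)
  = simplex_ring_map a (pzscale c (pw_ev x f)).
Proof. by rewrite simplex_ring_map_scale pw_nat. Qed.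
Definition pw_scale (c : l) f : pwpoly := pw_build (pw_scale_nat c f).

Fact pw_addA : associative pw_add.
Proof. by move=> f g h; apply: pw_evP => n x; apply: addrA. Qed.
Fact pw_addC : commutative pw_add.
Proof. by move=> f g; apply: pw_evP => n x; apply: addrC. Qed.
Fact pw_add0 : left_id pw_zero pw_add.
Proof. by move=> f; apply: pw_evP => n x; apply: add0r. Qed.
Fact pw_addN : left_inverse pw_zero pw_opp pw_add.
Proof. by move=> f; apply: pw_evP => n x; apply: addNr. Qed.

HB.instance Definition _ := GRing.isZmodule.Build pwpoly
  pw_addA pw_addC pw_add0 pw_addN.

Fact pw_mulA : associative pw_mul.
Proof. by move=> f g h; apply: pw_evP => n x; apply: mulrA. Qed.
Fact pw_mulC : commutative pw_mul.
Proof. by move=> f g; apply: pw_evP => n x; apply: mulrC. Qed.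
Fact pw_mul1 : left_id pw_one pw_mul.
Proof. by move=> f; apply: pw_evP => n x; apply: mul1r. Qed.
Fact pw_mulDl : left_distributive pw_mul pw_add.
Proof. by move=> f g h; apply: pw_evP => n x; apply: mulrDl. Qed.

HB.instance Definition _ := GRing.Zmodule_isComPzRing.Build pwpoly
  pw_mulA pw_mulC pw_mul1 pw_mulDl.

Fact pw_scaleA a b f : pw_scale a (pw_scale b f) = pw_scale (a * b) f.
Proof. by apply: pw_evP => n x; apply: pzscaleA. Qed.
Fact pw_scale1 : left_id 1 pw_scale.
Proof. by move=> f; apply: pw_evP => n x; apply: pzscale1. Qed.
Fact pw_scaleDr : right_distributive pw_scale +%R.
Proof. by move=> a f g; apply: pw_evP => n x; apply: pzscaleDr. Qed.
Fact pw_scaleDl f : {morph pw_scale^~ f : a b / a + b}.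
Proof. by move=> a b; apply: pw_evP => n x; apply: pzscaleDl. Qed.
Fact pw_scaleAl a f g : pw_scale a (f * g) = pw_scale a f * g.
Proof. by apply: pw_evP => n x; apply: pzscaleAl. Qed.
Fact pw_scaleAr a f g : pw_scale a (f * g) = f * pw_scale a g.
Proof. by apply: pw_evP => n x; apply: pzscaleAr. Qed.

HB.instance Definition _ := PzRing_isPzAlgebra.Build l pwpoly
  pw_scaleA pw_scale1 pw_scaleDr pw_scaleDl pw_scaleAl pw_scaleAr.

End PiecewisePolynomial.

Definition simplex (X : sset) : Type := {n : nat & X n}.

(* Eilenberg-Zilber: [x] is degenerate iff it is pulled back along a surjection
   onto a simplex of smaller dimension. *)
Definition degenerate (X : sset) (n : nat) (x : X n) : Prop :=
  exists m (a : delta n m) (y : X m),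
    [/\ (m < n)%N, forall j, exists i, a i = j & x = smap a y].

Definition finite_sset (X : sset) : Prop :=
  finite_set [set s : simplex X | ~ degenerate (projT2 s)].

Definition vertex (X : sset) (n : nat) (x : X n) (i : 'I_n.+1) : X 0%N :=
  smap (delta_cst i) x.

Definition star (X : sset) (v : X 0%N) : set (simplex X) :=
  [set s | exists i, vertex (projT2 s) i = v].

(* The simplicial subset generated by [S], as a set of simplices. *)
Definition sset_generated (X : sset) (S : set (simplex X)) : set (simplex X) :=
  [set s | exists2 t, S t &
     exists a : delta (projT1 s) (projT1 t), projT2 s = smap a (projT2 t)].

Definition star_sub (X : sset) (K : set (simplex X)) : set (simplex X) :=
  \bigcup_(v in [set v : X 0%N | K (existT _ 0%N v)]) star v.

Record saction (G : finGroupType) (X : sset) := SAction {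
  sact :> G -> shom X X;
  sact1 : forall n (x : X n), sact 1%g n x = x;
  sactM : forall g h n (x : X n), sact (g * h)%g n x = sact g n (sact h n x) }.

Definition free_saction (G : finGroupType) (X : sset) (rho : saction G X) :=
  forall n (x : X n) (g : G), g != 1%g -> rho g n x <> x.

Section QuotientSset.
Variables (G : finGroupType) (X : sset) (rho : saction G X).

Definition same_orbit n : rel (X n) := fun x y => [exists g, rho g n x == y].

Lemma same_orbit_equiv n : equiv_class_of (@same_orbit n).
Proof.
split=> [x|x y|y x z].
- by apply/existsP; exists 1%g; rewrite sact1.
- by apply/existsP/existsP => -[g /eqP <-]; exists g^-1%g;
    rewrite -sactM mulVg sact1.
- move=> /existsP[g /eqP <-] /existsP[h /eqP <-].
  by apply/existsP; exists (h * g)%g; rewrite sactM.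
Qed.

Canonical same_orbit_equivRel n := EquivRelPack (same_orbit_equiv n).

Definition orbit_simp n : choiceType := {eq_quot (same_orbit_equivRel n)}.

Definition to_orbit n (x : X n) : orbit_simp n :=
  \pi_({eq_quot (same_orbit_equivRel n)}) x.

Lemma to_orbit_eq n (x y : X n) :
  to_orbit x = to_orbit y <-> exists g, rho g n x = y.
Proof.
split=> [/eqmodP/existsP[g /eqP gx]|[g gx]]; first by exists g.
by apply/eqmodP/existsP; exists g; apply/eqP.
Qed.

Definition orbit_repr n (x : orbit_simp n) : X n :=
  repr (x : {eq_quot (same_orbit_equivRel n)}).

Lemma orbit_reprK n : cancel (@orbit_repr n) (@to_orbit n).
Proof. exact: reprK. Qed.

Definition orbit_map m n (a : delta m n) (x : orbit_simp n) : orbit_simp m :=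
  to_orbit (smap a (orbit_repr x)).

Lemma orbit_mapE m n (a : delta m n) (x : X n) :
  orbit_map a (to_orbit x) = to_orbit (smap a x).
Proof.
have /to_orbit_eq[g gx] := orbit_reprK (to_orbit x).
by apply/to_orbit_eq; exists g; rewrite shom_nat gx.
Qed.

Lemma orbit_map_id n (x : orbit_simp n) : orbit_map (delta_id n) x = x.
Proof. by rewrite -(orbit_reprK x) orbit_mapE smap_id. Qed.

Lemma orbit_map_comp m n p (b : delta n p) (a : delta m n) (x : orbit_simp p) :
  orbit_map (delta_comp b a) x = orbit_map a (orbit_map b x).
Proof. by rewrite -(orbit_reprK x) !orbit_mapE smap_comp. Qed.

Definition quotient_sset : sset :=
  @SSet orbit_simp orbit_map orbit_map_id orbit_map_comp.

End QuotientSset.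

Record galgebra (l : comPzRingType) (G : finGroupType) (A : pzAlgType l) :=
  GAlgebra {
    galg_act :> G -> A -> A;
    galg_actD : forall g, {morph galg_act g : a b / a + b};
    galg_actM : forall g, {morph galg_act g : a b / a * b};
    galg_act_1 : forall g, galg_act g 1 = 1;
    galg_actZ : forall g (c : l), {morph galg_act g : a / pzscale c a};
    galg_act1 : forall a, galg_act 1%g a = a;
    galg_act_mul : forall g h a,
      galg_act (g * h)%g a = galg_act g (galg_act h a) }.

Section PwAction.
Variables (l : comPzRingType) (G : finGroupType) (X : sset).
Variable rho : saction G X.

Fact pw_act_nat (g : G) (f : pwpoly l X) m n (a : delta m n) (x : X n) :
  pw_ev (rho g^-1%g m (smap a x)) f
  = simplex_ring_map a (pw_ev (rho g^-1%g n x) f).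
Proof. by rewrite shom_nat pw_nat. Qed.

Definition pw_act (g : G) (f : pwpoly l X) : pwpoly l X :=
  pw_build (pw_act_nat g f).

Fact pw_actD g : {morph pw_act g : a b / a + b}.
Proof. by move=> a b; apply: pw_evP. Qed.
Fact pw_actM g : {morph pw_act g : a b / a * b}.
Proof. by move=> a b; apply: pw_evP. Qed.
Fact pw_act_1 g : pw_act g 1 = 1.
Proof. exact: pw_evP. Qed.
Fact pw_actZ g (c : l) : {morph pw_act g : a / pzscale c a}.
Proof. by move=> a; apply: pw_evP. Qed.
Fact pw_act1 a : pw_act 1%g a = a.
Proof.
by apply: pw_evP => n x; rewrite /pw_ev /= /pw_ev invg1 sact1.
Qed.
Fact pw_act_mul g h a : pw_act (g * h)%g a = pw_act g (pw_act h a).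
Proof.
by apply: pw_evP => n x; rewrite /pw_ev /= /pw_ev /= invMg sactM.
Qed.

Definition pw_galgebra : galgebra G (pwpoly l X) :=
  GAlgebra pw_actD pw_actM pw_act_1 pw_actZ pw_act1 pw_act_mul.

End PwAction.

(* [G] being finite, the module A (x) l[G] is encoded as the finite functions
   G -> A: the function with value [a] at [g] and 0 elsewhere is a (x) g. *)
Definition crossed (l : comPzRingType) (G : finGroupType) (A : pzAlgType l)
  (rho : galgebra G A) : Type := {ffun G -> A}.

Section CrossedProduct.
Variables (l : comPzRingType) (G : finGroupType) (A : pzAlgType l).
Variable rho : galgebra G A.
Local Notation crossed := (crossed rho).

HB.instance Definition _ := GRing.Zmodule.on crossed.

Implicit Types x y z : crossed.

Definition crossed_gen (a : A) (g : G) : crossed :=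
  [ffun k => if k == g then a else 0].

Definition crossed_one : crossed := crossed_gen 1 1%g.

Definition crossed_mul x y : crossed :=
  [ffun k => \sum_(g : G) x g * rho g (y (g^-1 * k)%g)].

Lemma galg_act0 g : rho g 0 = 0.
Proof. by apply: (addIr (rho g 0)); rewrite -galg_actD !add0r. Qed.

Lemma galg_act_sum g (I : finType) (F : I -> A) :
  rho g (\sum_i F i) = \sum_i rho g (F i).
Proof. exact: (big_morph _ (galg_actD rho g) (galg_act0 g)). Qed.

Lemma crossed_mul_gen a g b h :
  crossed_mul (crossed_gen a g) (crossed_gen b h)
  = crossed_gen (a * rho g b) (g * h)%g.
Proof.
apply/ffunP => k; rewrite !ffunE (bigD1 g) //= big1 => [|g' /negPf ne].
  rewrite !ffunE eqxx addr0 (can2_eq (mulKVg g) (mulKg g)).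
  by case: eqP; rewrite // galg_act0 mulr0.
by rewrite !ffunE ne mul0r.
Qed.

Lemma crossed_mulA : associative crossed_mul.
Proof.
move=> x y z; apply/ffunP => k; rewrite !ffunE.
under eq_bigr => g _ do rewrite ffunE galg_act_sum mulr_sumr.
under [RHS]eq_bigr => h _ do rewrite ffunE mulr_suml.
rewrite [RHS]exchange_big /=; apply: eq_bigr => g _.
rewrite (reindex_inj (mulgI g^-1%g)) /=; apply: eq_bigr => h _.
rewrite galg_actM mulrA -galg_act_mul mulKVg; congr (_ * rho _ (z _)).
by rewrite invMg invgK -mulgA mulKVg.
Qed.

Lemma crossed_mul1 : left_id crossed_one crossed_mul.
Proof.
move=> x; apply/ffunP => k; rewrite !ffunE (bigD1 1%g) //= big1.
  by rewrite ffunE eqxx mul1r invg1 mul1g galg_act1 addr0.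
by move=> g /negPf ne; rewrite ffunE ne mul0r.
Qed.

Lemma crossed_mulr1 : right_id crossed_one crossed_mul.
Proof.
move=> x; apply/ffunP => k; rewrite !ffunE (bigD1 k) //= big1.
  by rewrite ffunE mulVg eqxx galg_act_1 mulr1 addr0.
move=> g /negPf ne; rewrite ffunE -eq_mulVg1 ne.
by rewrite galg_act0 mulr0.
Qed.

Lemma crossed_mulDl : left_distributive crossed_mul +%R.
Proof.
move=> x y z; apply/ffunP => k; rewrite !ffunE -big_split.
by apply: eq_bigr => g _; rewrite ffunE mulrDl.
Qed.

Lemma crossed_mulDr : right_distributive crossed_mul +%R.
Proof.
move=> x y z; apply/ffunP => k; rewrite !ffunE -big_split.
by apply: eq_bigr => g _; rewrite ffunE galg_actD mulrDr.
Qed.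

HB.instance Definition _ := GRing.Zmodule_isPzRing.Build crossed
  crossed_mulA crossed_mul1 crossed_mulr1 crossed_mulDl crossed_mulDr.

Definition crossed_scale (c : l) x : crossed := [ffun g => pzscale c (x g)].

Lemma crossed_scaleA a b x :
  crossed_scale a (crossed_scale b x) = crossed_scale (a * b) x.
Proof. by apply/ffunP => k; rewrite !ffunE pzscaleA. Qed.

Lemma crossed_scale1 : left_id 1 crossed_scale.
Proof. by move=> x; apply/ffunP => k; rewrite !ffunE pzscale1. Qed.

Lemma crossed_scaleDr : right_distributive crossed_scale +%R.
Proof. by move=> a x y; apply/ffunP => k; rewrite !ffunE pzscaleDr. Qed.

Lemma crossed_scaleDl x : {morph crossed_scale^~ x : a b / a + b}.
Proof. by move=> a b; apply/ffunP => k; rewrite !ffunE pzscaleDl. Qed.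

Let pzscale_sum (c : l) (I : finType) (F : I -> A) :
  pzscale c (\sum_i F i) = \sum_i pzscale c (F i).
Proof.
have pzscale0 : pzscale c (0 : A) = 0.
  by apply: (addIr (pzscale c 0)); rewrite -pzscaleDr !add0r.
exact: (big_morph _ (pzscaleDr c) pzscale0).
Qed.

Lemma crossed_scaleAl c x y : crossed_scale c (x * y) = crossed_scale c x * y.
Proof.
apply/ffunP => k; rewrite !ffunE pzscale_sum.
by apply: eq_bigr => g _; rewrite ffunE pzscaleAl.
Qed.

Lemma crossed_scaleAr c x y : crossed_scale c (x * y) = x * crossed_scale c y.
Proof.
apply/ffunP => k; rewrite !ffunE pzscale_sum.
by apply: eq_bigr => g _; rewrite ffunE galg_actZ pzscaleAr.
Qed.

HB.instance Definition _ := PzRing_isPzAlgebra.Build l crossed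
  crossed_scaleA crossed_scale1 crossed_scaleDr crossed_scaleDl
  crossed_scaleAl crossed_scaleAr.

End CrossedProduct.

(* As always for algebras over [l], the two actions of [l] on a bimodule
   are required to agree ([bimod_central]). *)
Record bimodule (l : comPzRingType) (A B : pzAlgType l) := Bimodule {
  bimod_sort :> zmodType;
  lact : A -> bimod_sort -> bimod_sort;
  ract : bimod_sort -> B -> bimod_sort;
  lactDr : forall a, {morph lact a : x y / x + y};
  lactDl : forall x, {morph lact^~ x : a b / a + b};
  lactA : forall a b x, lact a (lact b x) = lact (a * b) x;
  lact1 : forall x, lact 1 x = x;
  ractDl : forall b, {morph ract^~ b : x y / x + y};
  ractDr : forall x, {morph ract x : a b / a + b};
  ractA : forall x a b, ract (ract x a) b = ract x (a * b);
  ract1 : forall x, ract x 1 = x;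
  lractA : forall a x b, ract (lact a x) b = lact a (ract x b);
  bimod_central : forall (c : l) x, lact (pzscale c 1) x = ract x (pzscale c 1) }.

Section RegularBimodule.
Variables (l : comPzRingType) (A : pzAlgType l).

Fact regular_central (c : l) (x : A) : pzscale c 1 * x = x * pzscale c 1.
Proof. by rewrite -pzscaleAl -pzscaleAr mul1r mulr1. Qed.

Definition regular_bimodule : bimodule A A :=
  @Bimodule l A A A *%R *%R
    (fun a x y => mulrDr a x y) (fun x a b => mulrDl a b x)
    (fun a b x => mulrA a b x) (@mul1r A)
    (fun b x y => mulrDl x y b) (fun x a b => mulrDr x a b)
    (fun x a b => esym (mulrA x a b)) (@mulr1 A)
    (fun a x b => esym (mulrA a x b)) regular_central.

End RegularBimodule.

Section Tensor.
Variables (l : comPzRingType) (A B C : pzAlgType l).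
Variables (P : bimodule A B) (Q : bimodule B C).

(* The free abelian group on P * Q. *)
Definition tensor_free : Type := {malg int[(P * Q)%type]}.
HB.instance Definition _ := GRing.Zmodule.on tensor_free.

Definition tensor_gen (p : P) (q : Q) : tensor_free := << (1 : int) *g (p, q) >>.

Inductive tensor_rel : tensor_free -> Prop :=
| tensor_relDl p p' q :
    tensor_rel (tensor_gen (p + p') q - (tensor_gen p q + tensor_gen p' q))
| tensor_relDr p q q' :
    tensor_rel (tensor_gen p (q + q') - (tensor_gen p q + tensor_gen p q'))
| tensor_relA p b q :
    tensor_rel (tensor_gen (ract p b) q - tensor_gen p (lact b q)).

Definition tensor_null : {pred tensor_free} := fun x =>
  `[< forall S : {pred tensor_free}, zmod_closed S ->
        (forall r, tensor_rel r -> r \in S) -> x \in S >].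

Lemma tensor_null_zmod_closed : zmod_closed tensor_null.
Proof.
split; first by apply/asboolP => S [].
move=> x y /asboolP xN /asboolP yN; apply/asboolP => S SZ SR.
by case: (SZ) => _; apply; [apply: xN | apply: yN].
Qed.

HB.instance Definition _ := GRing.isZmodClosed.Build tensor_free
  tensor_null tensor_null_zmod_closed.

Definition tensor : Type := {ideal_quot tensor_null}.
HB.instance Definition _ := GRing.Zmodule.on tensor.

Definition to_tensor (x : tensor_free) : tensor := \pi_({ideal_quot tensor_null}) x.
Definition of_tensor (x : tensor) : tensor_free :=
  repr (x : {ideal_quot tensor_null}).

Lemma of_tensorK : cancel of_tensor to_tensor.
Proof. exact: reprK. Qed.

Lemma to_tensor_eq x y :
  to_tensor x = to_tensor y <-> x - y \in tensor_null.
Proof. by rewrite /to_tensor Quotient.idealrBE; split => [->|/eqP]. Qed.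

Lemma to_tensor_is_zmod_morphism : zmod_morphism to_tensor.
Proof. exact: (raddfB \pi_({ideal_quot tensor_null})). Qed.

HB.instance Definition _ := GRing.isZmodMorphism.Build tensor_free
  tensor to_tensor to_tensor_is_zmod_morphism.

Definition pure (p : P) (q : Q) : tensor := to_tensor (tensor_gen p q).

Lemma tensor_rel_eq x y : tensor_rel (x - y) -> to_tensor x = to_tensor y.
Proof. by move=> r; apply/to_tensor_eq/asboolP => S _; apply. Qed.

Lemma pureDl p p' q : pure (p + p') q = pure p q + pure p' q.
Proof.
rewrite /pure -raddfD; apply: tensor_rel_eq; exact: tensor_relDl.
Qed.

Lemma pureDr p q q' : pure p (q + q') = pure p q + pure p q'.
Proof.
rewrite /pure -raddfD; apply: tensor_rel_eq; exact: tensor_relDr.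
Qed.

Lemma pureA p b q : pure (ract p b) q = pure p (lact b q).
Proof. by apply: tensor_rel_eq; exact: tensor_relA. Qed.

Lemma tensor_sum (x : tensor) : exists r : seq (int * (P * Q)),
  x = \sum_(k <- r) pure k.2.1 k.2.2 *~ k.1.
Proof.
exists [seq (mcoeff k (of_tensor x), k) | k <- msupp (of_tensor x)].
rewrite big_map -[LHS]of_tensorK {1}(monalgE (of_tensor x)) raddf_sum.
apply: eq_bigr => -[p q] _ /=; rewrite -raddfMz; congr to_tensor.
by rewrite -[LHS]/(mkmalgU _ _) -[X in mkmalgU _ X]intz raddfMz.
Qed.

Lemma tensor_ext (Z : zmodType) (f g : tensor -> Z) :
  {morph f : x y / x + y} -> {morph g : x y / x + y} ->
  (forall p q, f (pure p q) = g (pure p q)) -> f =1 g.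
Proof.
move=> fD gD fg x.
have addP (h : tensor -> Z) : {morph h : x y / x + y} -> zmod_morphism h.
  by move=> hD y z; apply: (addIr (h z)); rewrite -hD !addrNK.
pose fA : {additive tensor -> Z} :=
  HB.pack f (GRing.isZmodMorphism.Build _ _ f (addP _ fD)).
pose gA : {additive tensor -> Z} :=
  HB.pack g (GRing.isZmodMorphism.Build _ _ g (addP _ gD)).
rewrite -[f]/(fA : _ -> _) -[g]/(gA : _ -> _).
have [r ->] := tensor_sum x; rewrite !raddf_sum; apply: eq_bigr => k _.
by rewrite !raddfMz /= fg.
Qed.

Section Lift.
Variables (Z : zmodType) (f : P -> Q -> Z).
Hypothesis fDl : forall p p' q, f (p + p') q = f p q + f p' q.
Hypothesis fDr : forall p q q', f p (q + q') = f p q + f p q'.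
Hypothesis fA : forall p b q, f (ract p b) q = f p (lact b q).

Definition tensor_prelift (x : tensor_free) : Z :=
  \sum_(k <- msupp x) f k.1 k.2 *~ mcoeff k x.

Lemma tensor_preliftw (d : {fset (P * Q)%type}) (x : tensor_free) :
  (msupp x `<=` d)%fset ->
  tensor_prelift x = \sum_(k <- d) f k.1 k.2 *~ mcoeff k x.
Proof.
move=> le; rewrite /tensor_prelift (big_fset_incl _ le) //= => k _.
by move=> /mcoeff_outdom ->.
Qed.

Lemma tensor_prelift_is_zmod_morphism : zmod_morphism tensor_prelift.
Proof.
move=> x y; rewrite (tensor_preliftw (msuppB_le x y)).
rewrite (tensor_preliftw (fsubsetUl (msupp x) (msupp y))).
rewrite (tensor_preliftw (fsubsetUr (msupp x) (msupp y))).
rewrite -sumrB; apply: eq_bigr => k _.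
by rewrite mcoeffB mulrzBr.
Qed.

HB.instance Definition _ := GRing.isZmodMorphism.Build tensor_free Z
  tensor_prelift tensor_prelift_is_zmod_morphism.

Lemma tensor_prelift_gen p q : tensor_prelift (tensor_gen p q) = f p q.
Proof. by rewrite (tensor_preliftw msuppU_le) big_seq_fset1 mcoeffUU. Qed.

Lemma tensor_prelift_null x : x \in tensor_null -> tensor_prelift x = 0.
Proof.
move=> /asboolP/(_ [pred y | tensor_prelift y == 0]) xN; apply/eqP/xN.
  split=> [|y z]; rewrite !inE ?raddf0 // => /eqP y0 /eqP z0.
  by rewrite tensor_prelift_is_zmod_morphism y0 z0 subrr.
have preD : {morph tensor_prelift : x y / x + y} by exact: raddfD.
move=> _ [p p' q|p q q'|p b q]; rewrite inE tensor_prelift_is_zmod_morphism.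
- by rewrite preD !tensor_prelift_gen fDl subrr.
- by rewrite preD !tensor_prelift_gen fDr subrr.
- by rewrite !tensor_prelift_gen fA subrr.
Qed.

Definition tensor_lift (x : tensor) : Z := tensor_prelift (of_tensor x).

Lemma tensor_liftE x : tensor_lift (to_tensor x) = tensor_prelift x.
Proof.
apply/eqP; rewrite -subr_eq0 -raddfB; apply/eqP/tensor_prelift_null.
by apply/to_tensor_eq; rewrite of_tensorK.
Qed.

Lemma tensor_liftD : {morph tensor_lift : x y / x + y}.
Proof.
move=> x y; rewrite -(of_tensorK x) -(of_tensorK y) -raddfD !tensor_liftE.
exact: raddfD.
Qed.

Lemma tensor_lift_pure p q : tensor_lift (pure p q) = f p q.
Proof. by rewrite tensor_liftE tensor_prelift_gen. Qed.

End Lift.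

Definition tensor_lact (a : A) : tensor -> tensor :=
  tensor_lift (fun p q => pure (lact a p) q).
Definition tensor_ract (x : tensor) (c : C) : tensor :=
  tensor_lift (fun p q => pure p (ract q c)) x.

Lemma tensor_lact_pure a p q : tensor_lact a (pure p q) = pure (lact a p) q.
Proof.
apply: tensor_lift_pure => *; rewrite ?lactDr ?pureDl ?pureDr //.
by rewrite -lractA pureA.
Qed.

Lemma tensor_ract_pure p q c : tensor_ract (pure p q) c = pure p (ract q c).
Proof.
apply: tensor_lift_pure => *; rewrite ?ractDl ?pureDl ?pureDr //.
by rewrite pureA lractA.
Qed.

Lemma tensor_lactDr a : {morph tensor_lact a : x y / x + y}.
Proof.
apply: tensor_liftD => *; rewrite ?lactDr ?pureDl ?pureDr //.
by rewrite -lractA pureA.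
Qed.

Lemma tensor_ractDl c : {morph tensor_ract^~ c : x y / x + y}.
Proof.
apply: tensor_liftD => *; rewrite ?ractDl ?pureDl ?pureDr //.
by rewrite pureA lractA.
Qed.

Let morphD (f g : tensor -> tensor) : {morph f : x y / x + y} ->
  {morph g : x y / x + y} -> {morph (fun x => f x + g x) : x y / x + y}.
Proof. by move=> fD gD x y; rewrite fD gD addrACA. Qed.

Let morphC (f g : tensor -> tensor) : {morph f : x y / x + y} ->
  {morph g : x y / x + y} -> {morph (fun x => f (g x)) : x y / x + y}.
Proof. by move=> fD gD x y; rewrite gD fD. Qed.

Lemma tensor_lactDl x : {morph tensor_lact^~ x : a b / a + b}.
Proof.
move=> a b; move: x; apply: tensor_ext => [||p q].
- exact: tensor_lactDr.
- by apply: morphD; apply: tensor_lactDr.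
- by rewrite !tensor_lact_pure lactDl pureDl.
Qed.

Lemma tensor_lactA a b x :
  tensor_lact a (tensor_lact b x) = tensor_lact (a * b) x.
Proof.
move: x; apply: tensor_ext => [||p q].
- by apply: morphC; apply: tensor_lactDr.
- exact: tensor_lactDr.
- by rewrite !tensor_lact_pure lactA.
Qed.

Lemma tensor_lact1 x : tensor_lact 1 x = x.
Proof.
move: x; apply: tensor_ext => [||p q] //; first exact: tensor_lactDr.
by rewrite tensor_lact_pure lact1.
Qed.

Lemma tensor_ractDr x : {morph tensor_ract x : a b / a + b}.
Proof.
move=> a b; move: x; apply: (@tensor_ext _ (tensor_ract^~ (a + b))
    (fun x => tensor_ract x a + tensor_ract x b)) => [||p q].
- exact: tensor_ractDl.
- by apply: (morphD (f := tensor_ract^~ a)); apply: tensor_ractDl.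
- by rewrite !tensor_ract_pure ractDr pureDr.
Qed.

Lemma tensor_ractA x a b :
  tensor_ract (tensor_ract x a) b = tensor_ract x (a * b).
Proof.
move: x; apply: (@tensor_ext _ (fun x => tensor_ract (tensor_ract x a) b)
    (tensor_ract^~ (a * b))) => [||p q].
- by apply: (morphC (f := tensor_ract^~ b)); apply: tensor_ractDl.
- exact: tensor_ractDl.
- by rewrite !tensor_ract_pure ractA.
Qed.

Lemma tensor_ract1 x : tensor_ract x 1 = x.
Proof.
move: x; apply: (@tensor_ext _ (tensor_ract^~ 1)) => [||p q] //.
  exact: tensor_ractDl.
by rewrite tensor_ract_pure ract1.
Qed.

Lemma tensor_lractA a x c :
  tensor_ract (tensor_lact a x) c = tensor_lact a (tensor_ract x c).
Proof.
move: x; apply: (@tensor_ext _ (fun x => tensor_ract (tensor_lact a x) c)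
    (fun x => tensor_lact a (tensor_ract x c))) => [||p q].
- apply: (morphC (f := tensor_ract^~ c)); first exact: tensor_ractDl.
  exact: tensor_lactDr.
- apply: (morphC (g := tensor_ract^~ c)); first exact: tensor_lactDr.
  exact: tensor_ractDl.
- by rewrite !(tensor_lact_pure, tensor_ract_pure).
Qed.

Lemma tensor_central (c : l) x :
  tensor_lact (pzscale c 1) x = tensor_ract x (pzscale c 1).
Proof.
move: x; apply: (@tensor_ext _ _ (tensor_ract^~ (pzscale c 1))) => [||p q].
- exact: tensor_lactDr.
- exact: tensor_ractDl.
- by rewrite tensor_lact_pure tensor_ract_pure bimod_central pureA bimod_central.
Qed.

Definition tensor_bimodule : bimodule A C :=
  @Bimodule l A C tensor tensor_lact tensor_ract
    tensor_lactDr tensor_lactDl tensor_lactA tensor_lact1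
    tensor_ractDl tensor_ractDr tensor_ractA tensor_ract1
    tensor_lractA tensor_central.

End Tensor.

Record bimodule_iso (l : comPzRingType) (A B : pzAlgType l)
    (M N : bimodule A B) (f : M -> N) : Prop := BimoduleIso {
  bimod_isoD : {morph f : x y / x + y};
  bimod_isoL : forall a x, f (lact a x) = lact a (f x);
  bimod_isoR : forall x b, f (ract x b) = ract (f x) b;
  bimod_iso_bij : bijective f }.

Definition morita_equivalent (l : comPzRingType) (R S : pzAlgType l) : Prop :=
  exists (P : bimodule S R) (Q : bimodule R S)
    (alpha : tensor_bimodule P Q -> regular_bimodule S)
    (beta : tensor_bimodule Q P -> regular_bimodule R),
  [/\ bimodule_iso alpha, bimodule_iso beta,
      forall (p p' : P) (q : Q),
        lact (alpha (pure p q)) p' = ract p (beta (pure q p')) &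
      forall (p : P) (q q' : Q),
        lact (beta (pure q p)) q' = ract q (alpha (pure p q'))].

(* Main.v *)
Require Import Defs.
From mathcomp Require Import all_boot all_algebra all_fingroup.
From mathcomp Require Import boolp classical_sets cardinality zify.

(* [A = l^X] is a Galois extension of its ring of invariants [l^(X/G)]: [A] is
   both halves of a Morita context, with pairings
   [alpha (p, q) = \sum_g p g(q) g] and [beta (q, p) = \sum_g g(q p)], and a
   Morita context whose two pairings hit 1 is an equivalence. For a vertex [v]
   let [t_v] be its barycentric coordinate. The [t_v] sum to 1, and
   [t_v * t_(g v) = 0] for [g != 1] because no simplex contains both [v] and
   [g v]. A power of [1 = \sum_v t_v] writes 1 as [\sum_v c_v t_v^2], so that
   [1 = alpha (\sum_v c_v t_v (x) t_v)]. Since [G] acts freely on the vertices,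
   summing [t_v] over orbit representatives gives an element of trace 1. *)

Set Implicit Arguments.
Unset Strict Implicit.
Unset Printing Implicit Defensive.

Import GRing.Theory Defs.
Local Open Scope classical_set_scope.
Local Open Scope ring_scope.

Lemma pzscale0 (l : comPzRingType) (A : pzAlgType l) (c : l) :
  pzscale c (0 : A) = 0.
Proof. by apply: (addIr (pzscale c 0)); rewrite -pzscaleDr !add0r. Qed.

(** * The map on a tensor product induced by one pairing of a Morita context *)

Section MoritaContext.
Variables (l : comPzRingType) (R S : pzAlgType l).
Variables (P : bimodule S R) (Q : bimodule R S).
Variables (f : P -> Q -> S) (h : Q -> P -> R).
Hypothesis fDl : forall p p' q, f (p + p') q = f p q + f p' q.
Hypothesis fDr : forall p q q', f p (q + q') = f p q + f p q'.
Hypothesis fA : forall p r q, f (ract p r) q = f p (lact r q).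
Hypothesis fL : forall s p q, f (lact s p) q = s * f p q.
Hypothesis fR : forall p q s, f p (ract q s) = f p q * s.
Hypothesis fh : forall p q p', lact (f p q) p' = ract p (h q p').

Definition context_map : tensor P Q -> S := tensor_lift f.

Lemma context_map_pure p q : context_map (pure p q) = f p q.
Proof. exact: tensor_lift_pure. Qed.

Lemma context_mapD : {morph context_map : x y / x + y}.
Proof. exact: tensor_liftD. Qed.

Lemma context_map_sum (I : Type) (r : seq I) (p : I -> P) (q : I -> Q) :
  context_map (\sum_(k <- r) pure (p k) (q k)) = \sum_(k <- r) f (p k) (q k).
Proof.
have map0 : context_map 0 = 0.
  by apply: (addIr (context_map 0)); rewrite -context_mapD !add0r.
rewrite (big_morph _ context_mapD map0).
by apply: eq_bigr => k _; apply: context_map_pure.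
Qed.

Lemma context_mapL s x : context_map (tensor_lact s x) = s * context_map x.
Proof.
move: x; apply: tensor_ext => [x y|x y|p q].
- by rewrite tensor_lactDr context_mapD.
- by rewrite context_mapD mulrDr.
- by rewrite tensor_lact_pure !context_map_pure fL.
Qed.

Lemma context_mapR x s : context_map (tensor_ract x s) = context_map x * s.
Proof.
move: x; apply: (@tensor_ext _ _ _ _ P Q _
  (fun x => context_map (tensor_ract x s))
  (fun x => context_map x * s)) => [x y|x y|p q].
- by rewrite tensor_ractDl context_mapD.
- by rewrite context_mapD mulrDl.
- by rewrite tensor_ract_pure !context_map_pure fR.
Qed.

Hypothesis hf : forall q p q', lact (h q p) q' = ract q (f p q').

(** On pure tensors, [p (x) q f(p', q') = p (x) h(q, p') q' = p h(q, p') (x) q' = f(p, q) p' (x)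
    q']. *)
Lemma context_map_swap x y :
  tensor_ract x (context_map y) = tensor_lact (context_map x) y.
Proof.
move: x; apply: (@tensor_ext _ _ _ _ P Q _
  (fun x => tensor_ract x (context_map y))) => [x x'|x x'|p q].
- exact: tensor_ractDl.
- by rewrite context_mapD tensor_lactDl.
move: y; apply: tensor_ext => [y y'|y y'|p' q'].
- by rewrite context_mapD tensor_ractDr.
- exact: tensor_lactDr.
rewrite !context_map_pure tensor_ract_pure tensor_lact_pure.
by rewrite -hf fh pureA.
Qed.

(* If [context_map u = 1], then [s |-> s u] is inverse to [context_map], since
   [context_map x * u = x * context_map u = x]. *)
Lemma context_map_iso u : context_map u = 1 ->
  @bimodule_iso l S S (tensor_bimodule P Q) (regular_bimodule S) context_map.
Proof.
move=> u1; split.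
- exact: context_mapD.
- exact: context_mapL.
- exact: context_mapR.
exists (fun s => tensor_lact s u) => [x|s].
  by rewrite -context_map_swap u1 tensor_ract1.
by rewrite context_mapL u1 mulr1.
Qed.

End MoritaContext.

(** * The Morita context of a Galois extension [i : B -> A] with trace [tr] *)

Section Galois.
Variables (l : comPzRingType) (G : finGroupType) (A B : pzAlgType l).
Variable rho : galgebra G A.
Variables (i : B -> A) (tr : A -> B).
Hypothesis comA : commutative (@GRing.mul A).
Hypothesis iD : {morph i : a b / a + b}.
Hypothesis iM : {morph i : a b / a * b}.
Hypothesis i1 : i 1 = 1.
Hypothesis iZ : forall c : l, {morph i : a / pzscale c a}.
Hypothesis i_inj : injective i.
Hypothesis i_inv : forall g b, rho g (i b) = i b.
Hypothesis i_tr : forall a, i (tr a) = \sum_(g : G) rho g a.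

Local Notation S := (crossed rho).

(* [(a g) p = a g(p)] and [q (a g) = g^-1(q a)]. *)
Definition galois_lact (x : S) (p : A) : A := \sum_(g : G) x g * rho g p.
Definition galois_ract (q : A) (x : S) : A :=
  \sum_(g : G) rho g^-1%g (q * x g).

Fact galois_lactDr x : {morph galois_lact x : p q / p + q}.
Proof.
move=> p q; rewrite -big_split; apply: eq_bigr => g _ /=.
by rewrite galg_actD mulrDr.
Qed.

Fact galois_lactDl p : {morph galois_lact^~ p : x y / x + y}.
Proof.
move=> x y; rewrite -big_split; apply: eq_bigr => g _ /=.
by rewrite ffunE mulrDl.
Qed.

Fact galois_lactA x y p :
  galois_lact x (galois_lact y p) = galois_lact (x * y) p.
Proof.
rewrite /galois_lact; under [RHS]eq_bigr do rewrite ffunE mulr_suml.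
rewrite [RHS]exchange_big /=; apply: eq_bigr => g _.
rewrite galg_act_sum mulr_sumr [RHS](reindex_inj (mulgI g)) /=.
by apply: eq_bigr => h _; rewrite mulKg galg_actM galg_act_mul mulrA.
Qed.

Lemma crossed_scale_oneE (c : l) g :
  (pzscale c 1 : S) g = if g == 1%g then pzscale c 1 else 0.
Proof.
rewrite [LHS]ffunE [_ g]ffunE; case: eqP => // _; exact: pzscale0.
Qed.

(** The case [c = 1] gives the unit law; the general case gives [bimod_central]. *)
Fact galois_lact_scale (c : l) p : galois_lact (pzscale c 1) p = pzscale c p.
Proof.
rewrite /galois_lact (bigD1 1%g) //= big1 => [|g /negPf ne].
  by rewrite crossed_scale_oneE eqxx galg_act1 addr0 -pzscaleAl mul1r.
by rewrite crossed_scale_oneE ne mul0r.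
Qed.

Fact galois_lact1 p : galois_lact 1 p = p.
Proof.
by rewrite -[1 in LHS](pzscale1 (s := S)) galois_lact_scale pzscale1.
Qed.

Fact galois_ractDl x : {morph galois_ract^~ x : p q / p + q}.
Proof.
move=> p q; rewrite -big_split; apply: eq_bigr => g _ /=.
by rewrite mulrDl galg_actD.
Qed.

Fact galois_ractDr q : {morph galois_ract q : x y / x + y}.
Proof.
move=> x y; rewrite -big_split; apply: eq_bigr => g _ /=.
by rewrite ffunE mulrDr galg_actD.
Qed.

Fact galois_ractA q x y :
  galois_ract (galois_ract q x) y = galois_ract q (x * y).
Proof.
rewrite /galois_ract.
under eq_bigr do rewrite mulr_suml galg_act_sum.
under [RHS]eq_bigr do rewrite ffunE mulr_sumr galg_act_sum.
rewrite exchange_big [RHS]exchange_big /=; apply: eq_bigr => g _.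
rewrite [RHS](reindex_inj (mulgI g)) /=; apply: eq_bigr => h _.
rewrite mulKg invMg galg_act_mul mulrA; congr (rho _ _).
by rewrite [RHS]galg_actM -[in RHS]galg_act_mul mulVg galg_act1.
Qed.

Fact galois_ract_scale (c : l) q : galois_ract q (pzscale c 1) = pzscale c q.
Proof.
rewrite /galois_ract (bigD1 1%g) //= big1 => [|g /negPf ne].
  by rewrite crossed_scale_oneE eqxx invg1 galg_act1 addr0 -pzscaleAr mulr1.
by rewrite crossed_scale_oneE ne mulr0 galg_act0.
Qed.

Fact galois_ract1 q : galois_ract q 1 = q.
Proof.
by rewrite -[1 in LHS](pzscale1 (s := S)) galois_ract_scale pzscale1.
Qed.

(** Closed by [Defined], since later proofs compute with the carrier and the two actions. *)
Definition galois_P : bimodule S B.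
Proof.
refine (@Bimodule l S B A galois_lact (fun p b => p * i b)
  galois_lactDr galois_lactDl galois_lactA galois_lact1 _ _ _ _ _ _).
- by move=> b p q; rewrite mulrDl.
- by move=> p a b; rewrite iD mulrDr.
- by move=> p a b; rewrite iM mulrA.
- by move=> p; rewrite i1 mulr1.
- move=> x p b; rewrite mulr_suml; apply: eq_bigr => g _.
  by rewrite galg_actM i_inv mulrA.
- by move=> c p; rewrite galois_lact_scale iZ i1 -pzscaleAr mulr1.
Defined.

Definition galois_Q : bimodule B S.
Proof.
refine (@Bimodule l B S A (fun b q => i b * q) galois_ract
  _ _ _ _ galois_ractDl galois_ractDr galois_ractA galois_ract1 _ _).
- by move=> b p q; rewrite mulrDr.
- by move=> p a b; rewrite iD mulrDl.
- by move=> a b p; rewrite iM mulrA.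
- by move=> p; rewrite i1 mul1r.
- move=> b q x; rewrite mulr_sumr; apply: eq_bigr => g _.
  by rewrite -mulrA galg_actM i_inv.
- by move=> c p; rewrite galois_ract_scale iZ i1 -pzscaleAl mul1r.
Defined.

Definition galois_alpha (p : galois_P) (q : galois_Q) : S :=
  [ffun g => (p : A) * rho g (q : A)].
Definition galois_beta (q : galois_Q) (p : galois_P) : B :=
  tr ((q : A) * (p : A)).

(** As [i] is injective, identities for [tr] are checked after applying [i], where [tr] becomes a
    sum over [G]. *)
Lemma galois_trD : {morph tr : a b / a + b}.
Proof.
move=> a b; apply: i_inj; rewrite iD !i_tr -big_split.
by apply: eq_bigr => g _; rewrite galg_actD.
Qed.

Lemma galois_trZ b a : tr (i b * a) = b * tr a.
Proof.
apply: i_inj; rewrite iM !i_tr mulr_sumr.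
by apply: eq_bigr => g _; rewrite galg_actM i_inv.
Qed.

Lemma galois_tr_act g a : tr (rho g a) = tr a.
Proof.
apply: i_inj; rewrite !i_tr [RHS](reindex_inj (mulIg g)) /=.
by apply: eq_bigr => h _; rewrite galg_act_mul.
Qed.

Lemma galois_tr_sum (F : G -> A) : tr (\sum_g F g) = \sum_g tr (F g).
Proof.
apply: (big_morph tr galois_trD).
by apply: (addIr (tr 0)); rewrite -galois_trD !add0r.
Qed.

(** The pairs in [r] are Galois coordinates: [alpha] sends the sum of the [k.1 (x) k.2] to 1. As
    [a0] has trace 1, [beta] sends [1 (x) a0] to 1. *)
Lemma galois_morita (r : seq (A * A)) (a0 : A) :
  (forall g, \sum_(k <- r) k.1 * rho g k.2 = if g == 1%g then 1 else 0) ->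
  \sum_(g : G) rho g a0 = 1 ->
  morita_equivalent B S.
Proof.
move=> r1 a1; exists galois_P, galois_Q.
have aDl p p' q :
    galois_alpha (p + p') q = galois_alpha p q + galois_alpha p' q.
  by apply/ffunP => g; rewrite !ffunE mulrDl.
have aDr p q q' :
    galois_alpha p (q + q') = galois_alpha p q + galois_alpha p q'.
  by apply/ffunP => g; rewrite !ffunE galg_actD mulrDr.
have aA p b q : galois_alpha (ract p b) q = galois_alpha p (lact b q).
  by apply/ffunP => g; rewrite !ffunE /= galg_actM i_inv mulrA.
have aL x p q : galois_alpha (lact x p) q = x * galois_alpha p q.
  apply/ffunP => k; rewrite !ffunE /= mulr_suml; apply: eq_bigr => g _.
  by rewrite ffunE galg_actM -galg_act_mul mulKVg mulrA.
have aR p q x : galois_alpha p (ract q x) = galois_alpha p q * x.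
  apply/ffunP => k; rewrite !ffunE /= galg_act_sum mulr_sumr.
  (* With [k * g^-1] as index, the second factor is evaluated at [g]. *)
  rewrite [RHS](reindex_inj (inj_comp (mulgI k) invg_inj)) /=.
  apply: eq_bigr => g _; rewrite ffunE invMg invgK mulgKV -mulrA -galg_actM.
  by rewrite galg_act_mul.
have bDl q q' p : galois_beta (q + q') p = galois_beta q p + galois_beta q' p.
  by rewrite /galois_beta mulrDl galois_trD.
have bDr q p p' : galois_beta q (p + p') = galois_beta q p + galois_beta q p'.
  by rewrite /galois_beta mulrDr galois_trD.
have bA q x p : galois_beta (ract q x) p = galois_beta q (lact x p).
  rewrite /galois_beta /= mulr_suml mulr_sumr !galois_tr_sum.
  (* Invariance of the trace turns [g^-1(q x_g) p] into [q x_g g(p)]. *)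
  apply: eq_bigr => g _; rewrite -[LHS](galois_tr_act g) galg_actM.
  by rewrite -galg_act_mul mulgV galg_act1 mulrA.
have bL b q p : galois_beta (lact b q) p = b * galois_beta q p.
  by rewrite /galois_beta /= -mulrA galois_trZ.
have bR q p b : galois_beta q (ract p b) = galois_beta q p * b.
  apply: i_inj; rewrite iM comA -iM -galois_trZ /galois_beta /=.
  by rewrite mulrA comA.
have ab p q p' : lact (galois_alpha p q) p' = ract p (galois_beta q p').
  rewrite /= i_tr mulr_sumr; apply: eq_bigr => g _.
  by rewrite ffunE galg_actM mulrA.
have ba q p q' : lact (galois_beta q p) q' = ract q (galois_alpha p q').
  rewrite /= i_tr mulr_suml (reindex_inj invg_inj); apply: eq_bigr => g _ /=.
  by rewrite ffunE mulrA [RHS]galg_actM -[in RHS]galg_act_mul mulVg galg_act1.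
exists (context_map galois_alpha), (context_map galois_beta).
have u1 : context_map galois_alpha
    (\sum_(k <- r) @pure _ _ _ _ galois_P galois_Q k.1 k.2) = 1.
  rewrite context_map_sum //; apply/ffunP => g; rewrite sum_ffunE ffunE -r1.
  by apply: eq_bigr => k _; rewrite ffunE.
have w1 : context_map galois_beta (@pure _ _ _ _ galois_Q galois_P 1 a0) = 1.
  by rewrite context_map_pure //; apply: i_inj; rewrite i1 i_tr mul1r a1.
split.
- exact: (context_map_iso aDl aDr aA aL aR ab ba u1).
- exact: (context_map_iso bDl bDr bA bL bR ba ab w1).
- by move=> p p' q; rewrite !context_map_pure.
- by move=> p q q'; rewrite !context_map_pure.
Qed.

(* The elements that can replace 1 in the first hypothesis of [galois_morita]
   form an ideal [I], and [I] contains the squares of the members of [t]. *)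
Lemma orthogonal_cover_morita (t : seq A) (a0 : A) :
  (forall x g, x \in t -> g != 1%g -> x * rho g x = 0) ->
  \sum_(x <- t) x = 1 -> \sum_(g : G) rho g a0 = 1 ->
  morita_equivalent B S.
Proof.
pose I a := exists r : seq (A * A), forall g,
  \sum_(k <- r) k.1 * rho g k.2 = if g == 1%g then a else 0.
have I0 : I 0 by exists [::] => g; rewrite big_nil if_same.
have ID a b : I a -> I b -> I (a + b).
  move=> [r ra] [r' rb]; exists (r ++ r') => g.
  by rewrite big_cat ra rb /=; case: eqP; rewrite ?addr0.
have IM c a : I a -> I (c * a).
  move=> [r ra]; exists [seq (c * k.1, k.2) | k <- r] => g.
  rewrite big_map; under eq_bigr do rewrite /= -mulrA.
  by rewrite -mulr_sumr ra; case: eqP; rewrite ?mulr0.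
move=> tg t1 a1.
(* Partial sums of [t] need not be 1, so the induction on [t] has to carry an exponent. *)
suff: exists n, I ((\sum_(x <- t) x) ^+ n).
  by case=> n; rewrite t1 expr1n => -[r r1]; apply: (galois_morita r1 a1).
have {tg} tI x : x \in t -> I (x * x).
  move=> xt; exists [:: (x, x)] => g; rewrite big_seq1.
  by case: eqP => [->|/eqP ne]; rewrite ?galg_act1 ?tg.
(* The empty sum needs exponent 1, because [0 ^+ 0 = 1]. *)
elim: t tI {t1} => [|x t IHt] tI; first by exists 1; rewrite big_nil expr1.
have [|n In] := IHt; first by move=> y yt; apply: tI; rewrite inE yt orbT.
(* Every term of the binomial expansion of [(x + y) ^+ n.+1] is divisible by [y ^+ n] (if [n <= k])
   or by [x ^+ 2] (if [k < n]). *)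
exists n.+1; rewrite big_cons; set y := \sum_(j <- t) j in In *.
rewrite exprDn_comm; last exact: comA.
apply: big_ind => // k _; rewrite -mulr_natl; apply: (IM).
have [le_nk|lt_kn] := leqP n k.
  by rewrite -(subnK le_nk) exprD !mulrA; apply: IM.
have -> : (n.+1 - k = (n.-1 - k) + 2)%N by lia.
by rewrite comA exprD mulrA expr2; apply/IM/tI/mem_head.
Qed.
End Galois.

(** * Barycentric coordinates as piecewise polynomial functions *)

Lemma vertex0 (X : sset) (v : X 0) i : vertex v i = v.
Proof.
rewrite -[RHS]smap_id; congr smap.
by apply: deltaP => j; rewrite !ffunE !ord1.
Qed.

Section HatFunctions.
Variables (l : comPzRingType) (X : sset).

(** Vertex [j] of [smap a x] is vertex [a j] of [x], and [t_i] pulls back to the sum of the [t_j]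
    with [a j = i]; group the [j] by [a j]. *)
Fact hat_nat (U : pred (X 0)) m n (a : delta m n) (x : X n) :
  \sum_(i | U (vertex (smap a x) i)) svar l i =
  simplex_ring_map a (\sum_(i | U (vertex x i)) svar l i).
Proof.
have vE i : vertex (smap a x) i = vertex x (a i).
  rewrite /vertex -smap_comp; congr smap.
  by apply: deltaP => j; rewrite !ffunE.
rewrite rmorph_sum; under [RHS]eq_bigr do rewrite /= simplex_ring_map_svar.
rewrite (partition_big a (fun i => U (vertex x i))) /=; last first.
  by move=> i; rewrite vE.
apply: eq_bigr => i Ui; apply: eq_bigl => j; rewrite vE.
by case: (a j =P i) => [->|]; rewrite ?Ui ?andbF.
Qed.

(** The sum of the coordinates [t_v] for [v] in [U]. Summing over positions counts a repeated vertex
    of a simplex as often as it occurs. *)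
Definition hat (U : pred (X 0)) : pwpoly l X := pw_build (@hat_nat U).

Lemma hat_ev U n (x : X n) :
  pw_ev x (hat U) = \sum_(i | U (vertex x i)) svar l i.
Proof. by []. Qed.

Lemma pw_ev_sum n (x : X n) (I : Type) (r : seq I) (F : I -> pwpoly l X) :
  pw_ev x (\sum_(i <- r) F i) = \sum_(i <- r) pw_ev x (F i).
Proof. exact: (big_morph (pw_ev x)). Qed.

Lemma sum_hat (s : seq (X 0)) :
  uniq s -> (forall v, v \in s) -> \sum_(v <- s) hat (pred1 v) = 1.
Proof.
move=> s_uniq s_all; apply: pw_evP => n x; rewrite pw_ev_sum.
rewrite -[RHS](sum_svar l n).
under eq_bigr do rewrite hat_ev big_mkcond.
rewrite exchange_big /=; apply: eq_bigr => i _.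
rewrite (bigD1_seq (vertex x i)) //= eqxx big1 ?addr0 // => v.
by rewrite eq_sym => /negPf ->.
Qed.
End HatFunctions.

(** A 0-simplex is non-degenerate and is its own first vertex, so all vertices occur as first
    vertices of non-degenerate simplices. *)
Lemma vertices_finite (X : sset) : finite_sset X ->
  exists2 s : seq (X 0), uniq s & forall v, v \in s.
Proof.
move=> finX; pose f (s : simplex X) : X 0 := vertex (projT2 s) ord0.
have /finite_seqP[s sE] : finite_set [set: X 0].
  apply: sub_finite_set (finite_image f finX) => v _.
  exists (existT _ 0 v); last exact: vertex0.
  by move=> /= [m [a [y []]]].
exists (undup s) => [|v]; first exact: undup_uniq.
by rewrite mem_undup; have : [set: X 0] v by []; rewrite sE.
Qed.

(** * Pullback from [X/G], trace to [X/G], and the action on coordinates *)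

Section Quotient.
Variables (l : comPzRingType) (G : finGroupType) (X : sset) (rho : saction G X).

Fact pw_pullback_nat (f : pwpoly l (quotient_sset rho))
    m n (a : delta m n) (x : X n) :
  pw_ev (to_orbit rho (smap a x) : quotient_sset rho m) f =
  simplex_ring_map a (pw_ev (to_orbit rho x : quotient_sset rho n) f).
Proof. by rewrite -pw_nat -orbit_mapE. Qed.

Definition pw_pullback f : pwpoly l X := pw_build (pw_pullback_nat f).

Lemma orbit_sum n (x y : X n) (f : pwpoly l X) :
  to_orbit rho x = to_orbit rho y ->
  \sum_(g : G) pw_ev (rho g n x) f = \sum_(g : G) pw_ev (rho g n y) f.
Proof.
move=> /to_orbit_eq[g <-]; rewrite [LHS](reindex_inj (mulIg g)).
by apply: eq_bigr => h _; rewrite sactM.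
Qed.

(** Chosen representatives need not be compatible with [smap], but by [orbit_sum] the sum over [G]
    depends only on the orbit. *)
Fact pw_trace_nat (f : pwpoly l X)
    m n (a : delta m n) (x : quotient_sset rho n) :
  \sum_(g : G) pw_ev (rho g m (orbit_repr (smap a x))) f =
  simplex_ring_map a (\sum_(g : G) pw_ev (rho g n (orbit_repr x)) f).
Proof.
rewrite rmorph_sum -(orbit_reprK x); move: (orbit_repr x) => z.
rewrite [smap _ _]orbit_mapE (orbit_sum f (orbit_reprK _)) /=.
rewrite -rmorph_sum (orbit_sum f (orbit_reprK _)) rmorph_sum.
by apply: eq_bigr => g _; rewrite shom_nat; apply: pw_nat.
Qed.

Definition pw_trace f : pwpoly l (quotient_sset rho) :=
  pw_build (pw_trace_nat f).

Lemma pw_pullback_inj : injective pw_pullback.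
Proof.
move=> f h fh; apply: pw_evP => n y; rewrite -(orbit_reprK y).
exact: (congr1 (pw_ev (orbit_repr y)) fh).
Qed.

Lemma pw_pullback_trace f :
  pw_pullback (pw_trace f) = \sum_(g : G) pw_act rho g f.
Proof.
(* The inversion matches [pw_act rho g f], which evaluates [f] at [g^-1 x]. *)
apply: pw_evP => n x; rewrite pw_ev_sum (reindex_inj invg_inj) /=.
rewrite -[LHS]/(\sum_(g : G) pw_ev (rho g n (orbit_repr (to_orbit rho x))) f).
rewrite (orbit_sum f (orbit_reprK _)).
by apply: eq_bigr => g _; rewrite -[RHS]/(pw_ev _ f) invgK.
Qed.

Lemma pw_pullback_inv g f : pw_act rho g (pw_pullback f) = pw_pullback f.
Proof.
apply: pw_evP => n x.
have xg : to_orbit rho (rho g^-1%g n x) = to_orbit rho x.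
  by apply/to_orbit_eq; exists g; rewrite -sactM mulgV sact1.
rewrite -[LHS]/(pw_ev (to_orbit rho _ : quotient_sset rho n) f).
by rewrite xg.
Qed.

Lemma vertex_act g n (x : X n) k : vertex (rho g n x) k = rho g 0 (vertex x k).
Proof. by rewrite /vertex shom_nat. Qed.

(* Exactly one translate of each vertex is the representative of its orbit. *)
Lemma sum_act_hat_repr (freeG : free_saction rho) :
  \sum_(g : G)
    pw_act rho g (hat l (fun v => orbit_repr (to_orbit rho v) == v)) = 1.
Proof.
pose U (v : X 0) := orbit_repr (to_orbit rho v) == v.
apply: pw_evP => n x; rewrite pw_ev_sum (reindex_inj invg_inj) /=.
rewrite -[RHS](sum_svar l n).
have actE g : pw_ev x (pw_act rho g^-1 (hat l U)) =
    \sum_k if U (rho g 0 (vertex x k)) then svar l k else 0.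
  rewrite -[LHS]/(pw_ev (rho g^-1^-1%g n x) (hat l U)) invgK hat_ev.
  by rewrite big_mkcond; apply: eq_bigr => k _; rewrite vertex_act.
rewrite (eq_bigr _ (fun g _ => actE g)) {actE}.
rewrite exchange_big /=; apply: eq_bigr => k _; rewrite -big_mkcond /=.
(* [h] carries the [k]-th vertex to its orbit representative; by freeness no other element does, so
   [t_k] survives exactly once. *)
have /to_orbit_eq[h hx] := esym (orbit_reprK (to_orbit rho (vertex x k))).
apply: (big_pred1 h) => g; rewrite /U.
have -> : to_orbit rho (rho g 0 (vertex x k)) = to_orbit rho (vertex x k).
  by apply/esym/to_orbit_eq; exists g.
rewrite -hx pred1E; apply/eqP/eqP => [gh|->//]; apply/eqP.
rewrite eq_mulVg1; apply/negPn/negP => /(freeG _ (vertex x k)).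
by apply; rewrite sactM -gh -sactM mulVg sact1.
Qed.

(** If [x] lacks [v] or [g v] as a vertex, one factor is an empty sum on [x]. Otherwise [x] lies in
    the star of [v] and in that of [g v], a vertex of its own closed star, against the
    hypothesis. *)
Lemma hat_act_orthogonal (v : X 0) g :
  star v `&` star_sub (sset_generated (star (rho g 0%N v))) = set0 ->
  hat l (pred1 v) * pw_act rho g (hat l (pred1 v)) = 0.
Proof.
move=> vg; apply: pw_evP => n x.
rewrite -[LHS]/(pw_ev x (hat l (pred1 v)) *
  pw_ev (rho g^-1%g n x) (hat l (pred1 v))).
rewrite !hat_ev; have [/existsP[k /eqP xk]|/existsPn no_v] :=
  boolP [exists k, vertex x k == v]; last first.
  by rewrite big_pred0 ?mul0r // => k; apply/negbTE/no_v.
rewrite [X in _ * X]big_pred0 ?mulr0 // => j /=; apply/negP => /eqP xj.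
suff: set0 (existT _ n x : simplex X) by [].
rewrite -vg; split; first by exists k.
exists (rho g 0 v); last first.
  by exists j; rewrite -xj vertex_act -sactM mulgV sact1.
exists (existT _ 0 (rho g 0 v)); first by exists ord0; apply: vertex0.
by exists (delta_id 0); rewrite /= smap_id.
Qed.
End Quotient.

Theorem theorem1p3 (l : comPzRingType) (G : finGroupType) (X : sset)
    (rho : saction G X) (finX : finite_sset X) (freeG : free_saction rho)
    (starG : forall (v : X 0%N) (g : G), g != 1%g ->
       star v `&` star_sub (sset_generated (star (rho g 0%N v))) = set0) :
  morita_equivalent (pwpoly l (quotient_sset rho)) (crossed (pw_galgebra l rho)).
Proof.
have [s s_uniq s_all] := vertices_finite finX.
(* The cover [t] consists of the coordinates of all vertices; the last goal fixes [a0] as the hat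
   function of the orbit representatives. *)
apply: (orthogonal_cover_morita (rho := pw_galgebra l rho)
  (i := @pw_pullback l G X rho) (tr := @pw_trace l G X rho) _ _ _ _ _ _ _ _
  (t := [seq hat l (pred1 v) | v <- s])).
- exact: mulrC.
- by move=> f h; apply: pw_evP.
- by move=> f h; apply: pw_evP.
- exact: pw_evP.
- by move=> c f; apply: pw_evP.
- exact: pw_pullback_inj.
- exact: pw_pullback_inv.
- exact: pw_pullback_trace.
- by move=> _ g /mapP[v _ ->] g1; apply/hat_act_orthogonal/starG.
- by rewrite big_map sum_hat.
- exact: sum_act_hat_repr.
Qed.
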